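(* Let $(A,\cdot,\bullet)$ be a two-sided skew brace with associative $\star$-product. Put $B:=A\star A$, $D:=[A^{\cdot},A^{\cdot}]$, $I:=B\cap D$, and $T:=A/B$, $R:=A/D$, $C:=A/(BD)$ (quotient skew braces). Then $C\cong R/R^2$ is a trivial brace. The natural quotient maps $A\to T$ and $A\to R$, together with the natural maps $T\to C$ and $R\to C$, give a canonical isomorphism of skew braces \[A/I\ \cong\ T\times_C R .\] In particular, $A$ is a central extension of this fibre product, with kernel $I\subseteq\operatorname{Ann}(A)$.
   Context: A skew brace is a triple $(A,\cdot,\bullet)$ where $A^{\cdot}=(A,\cdot)$ and $A^{\bullet}=(A,\bullet)$ are groups with the same identity $1$ such that $a\bullet(b\cdot c)=(a\bullet b)\cdot a^{-1}\cdot(a\bullet c)$ for all $a,b,c\in A$, where $a^{-1}$ is the inverse in $A^{\cdot}$. It is two-sided if in addition $(a\cdot b)\bullet c=(a\bullet c)\cdot c^{-1}\cdot(b\bullet c)$ for all $a,b,c$. Put $\lambda_a(b):=a^{-1}\cdot(a\bullet b)$; $\lambda:A^{\bullet}\to\operatorname{Aut}(A^{\cdot})$ is a group morphism. The $\star$-product is $a\star b:=a^{-1}\cdot(a\bullet b)\cdot b^{-1}$, and $A\star A$ is the subgroup of $A^{\cdot}$ generated by all $a\star b$. An ideal of $A$ is a subset that is a normal subgroup of both $A^{\cdot}$ and $A^{\bullet}$ and is mapped into itself by every $\lambda_a$; one can form the quotient skew brace by an ideal. Under the stated hypotheses $B$, $D$, $BD$ and $I$ are ideals, where $[A^{\cdot},A^{\cdot}]$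 is the commutator subgroup of $A^{\cdot}$ and $BD=\{b\cdot d\mid b\in B, d\in D\}$. A skew brace is trivial if its two operations coincide; a brace is a skew brace with abelian $A^{\cdot}$. The annihilator is $\operatorname{Ann}(A):=Z(A^{\cdot})\cap\ker(\lambda)\cap\operatorname{Fix}(\lambda)$, where $\operatorname{Fix}(\lambda)=\{x\in A\mid \lambda_a(x)=x\ \forall a\in A\}$. $R=A/D$ is a (non-unital) radical ring with addition $(aD)+(bD):=(a\cdot b)D$ and multiplication $(aD)(bD):=(a\star b)D$, and the corresponding brace (with $r\bullet s=r+rs+s$) is the quotient skew brace $A/D$; $R^2$ is the additive subgroup of $R$ generated by all products $rs$, and $R/R^2$ is the quotient by it. With $q_T:T\to C$ and $q_R:R\to C$ the natural quotient maps, the fibre product is the sub-skew-brace $T\times_C R=\{(t,r)\in T\times R\mid q_T(t)=q_R(r)\}$ of the direct product. *)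

(* Defs.v *)
From HB Require Import structures.
From mathcomp Require Import all_boot ssralg.
From mathcomp Require Import boolp classical_sets.

Set Implicit Arguments.
Unset Strict Implicit.
Unset Printing Implicit Defensive.

Import GRing.Theory.

Reserved Notation "x ** y" (at level 40, left associativity).

Local Open Scope classical_set_scope.
Local Open Scope quotient_scope.
Local Open Scope group_scope.

(* A groupType carries a choice operator; this is no restriction, since every
   type can be given one by mathcomp.classical.boolp. *)

HB.mixin Record isSkewBrace A of Group A := {
  bul : A -> A -> A;
  binv : A -> A;
  bulA : associative bul;
  bul1g : left_id 1 bul;
  bulg1 : right_id 1 bul;
  bulVg : left_inverse 1 binv bul;
  bulgV : right_inverse 1 binv bul;
  bulM : forall a b c : A, bul a (b * c) = bul a b * a^-1 * bul a c
}.

#[short(type="skewBraceType")]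
HB.structure Definition SkewBrace := {A of isSkewBrace A & Group A}.

Bind Scope group_scope with SkewBrace.sort.

Notation "x ** y" := (bul x y) : group_scope.

HB.mixin Record isTwoSided A of SkewBrace A := {
  bulMl : forall a b c : A, (a * b) ** c = (a ** c) * c^-1 * (b ** c)
}.

#[short(type="twoSidedSkewBraceType")]
HB.structure Definition TwoSidedSkewBrace := {A of isTwoSided A & SkewBrace A}.

Bind Scope group_scope with TwoSidedSkewBrace.sort.

HB.mixin Record isBulMultiplicative (A B : skewBraceType) (f : A -> B) := {
  gmulfB : {morph f : x y / x ** y}
}.

HB.structure Definition SkewBraceMorphism (A B : skewBraceType) :=
  {f of isMultiplicative A B f & isBulMultiplicative A B f}.

Notation "{ 'skewbrace' A -> B }" := (SkewBraceMorphism.type A%type B%type)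
  (at level 0, A at level 98, B at level 99,
   format "{ 'skewbrace'  A  ->  B }") : type_scope.

(* The group $(A, \bullet)$, on a copy of A. *)
Definition adj (A : skewBraceType) : Type := A.

HB.instance Definition _ (A : skewBraceType) := Choice.on (adj A).
HB.instance Definition _ (A : skewBraceType) :=
  isGroup.Build (adj A) (@bulA A) (@bul1g A) (@bulg1 A) (@bulVg A) (@bulgV A).

Section Subgroups.
Variable G : groupType.
Implicit Types (H S : set G).

Definition subgroup_set H := H 1 /\ (forall x y, H x -> H y -> H (x * y^-1)).

Definition normal_subgroup H :=
  subgroup_set H /\ (forall x y, H x -> H (x ^ y)).

Definition gen_subgroup S : set G := smallest subgroup_set S.

Definition commutator_subgroup : set G :=
  gen_subgroup [set [~ x, y] | x in setT & y in setT].

Definition center_set : set G := [set x | forall y, commute x y].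

Lemma subgroupV H x : subgroup_set H -> H x -> H x^-1.
Proof. by move=> [H1 HF] Hx; rewrite -[x^-1]mul1g; apply: HF. Qed.

Lemma subgroupM H x y : subgroup_set H -> H x -> H y -> H (x * y).
Proof.
move=> sH Hx Hy; rewrite -[y]invgK; apply: sH.2 => //; exact: subgroupV.
Qed.

Lemma gen_subgroupP S : subgroup_set (gen_subgroup S).
Proof.
split=> [|x y Sx Sy] H /= [sH SH]; first exact: sH.1.
by apply: sH.2; [apply: Sx | apply: Sy].
Qed.

Lemma mem_gen S x : S x -> gen_subgroup S x.
Proof. exact: sub_gen_smallest. Qed.

Lemma gen_morph S H (f : G -> G) : {morph f : x y / x * y} ->
  subgroup_set H -> (forall x, S x -> H (f x)) ->
  forall x, gen_subgroup S x -> H (f x).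
Proof.
move=> fM sH SH x; apply: (@smallest_sub _ _ _ (f @^-1` H)) => //=.
have f1 : f 1 = 1 by apply: (@mulgI _ (f 1)); rewrite -fM !mulg1.
split=> /= [|y z Hy Hz]; first by rewrite f1; case: sH.
have -> : f (y * z^-1) = f y * (f z)^-1.
  by rewrite fM; congr (_ * _); apply/esym/mulg1_eq; rewrite -fM mulgV.
exact: sH.2.
Qed.

End Subgroups.

Arguments commutator_subgroup G : clear implicits.
Arguments center_set G : clear implicits.

Section SkewBraceTheory.
Variable A : skewBraceType.
Implicit Types (a b c x y : A) (I : set A).

Definition lam a b : A := a^-1 * (a ** b).

Definition star a b : A := a^-1 * (a ** b) * b^-1.

Definition star_subgroup : set A :=
  gen_subgroup [set star a b | a in setT & b in setT].

Definition is_ideal I :=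
  [/\ normal_subgroup I, @normal_subgroup (adj A) I
    & forall a x, I x -> I (lam a x)].

Definition ker_lam : set A := [set a | forall b, lam a b = b].

Definition Fix_lam : set A := [set x | forall a, lam a x = x].

Definition Ann : set A := center_set A `&` ker_lam `&` Fix_lam.

Definition trivial_skew_brace := forall a b, a ** b = a * b.

Definition is_brace := forall a b, a * b = b * a.

Lemma bulE a b : a ** b = a * lam a b.
Proof. by rewrite /lam mulVKg. Qed.

Lemma lamM a : {morph lam a : b c / b * c}.
Proof. by move=> b c; rewrite /lam bulM !mulgA. Qed.

Lemma lam1 a : lam a 1 = 1.
Proof. by apply: (@mulgI _ (lam a 1)); rewrite -lamM !mulg1. Qed.

Lemma lamV a b : lam a b^-1 = (lam a b)^-1.
Proof. by apply/esym/mulg1_eq; rewrite -lamM mulgV lam1. Qed.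

Lemma lam1l b : lam 1 b = b.
Proof. by rewrite /lam bul1g invg1 mul1g. Qed.

Lemma lamB a b c : lam (a ** b) c = lam a (lam b c).
Proof.
apply: (@mulgI _ (a ** b)); rewrite -bulE -bulA (bulE b) bulM -!mulgA.
by congr (_ * _).
Qed.

Lemma binvK : involutive (@binv A).
Proof. exact: (@invgK (adj A)). Qed.

Lemma lamK a : cancel (lam a) (lam (binv a)).
Proof. by move=> b; rewrite -lamB bulVg lam1l. Qed.

Lemma lamVK a : cancel (lam (binv a)) (lam a).
Proof. by move=> b; rewrite -lamB bulgV lam1l. Qed.

Lemma starE a b : star a b = lam a b * b^-1. Proof. by []. Qed.

Lemma lam_star a b : lam a b = star a b * b.
Proof. by rewrite starE mulgVK. Qed.

Lemma binvE a : binv a = (lam (binv a) a)^-1.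
Proof.
by apply: (@mulIg _ (lam (binv a) a)); rewrite -bulE bulVg mulVg.
Qed.

Lemma starM a b c : star a (b * c) = star a b * (star a c) ^ b^-1.
Proof. by rewrite !starE lamM conjgE invgK invgM !mulgA mulgVK. Qed.

Definition conjb c a : A := c ** a ** binv c.

Lemma lam_starJ c a b : lam c (star a b) = star (conjb c a) (lam c b).
Proof. by rewrite !starE lamM lamV /conjb !lamB lamK. Qed.

Lemma conjbE c x :
  conjb c x = (lam c x * lam c (star x (binv c))) ^ c^-1.
Proof.
rewrite /conjb -bulA (bulE x) lam_star mulgA bulM.
rewrite bulgV mulg1 bulE lamM conjgE invgK !mulgA.
by rewrite -!mulgA.
Qed.

Lemma ideal_crit I : subgroup_set I -> (forall x y, I x -> I (x ^ y)) ->
  (forall a x, I x -> I (lam a x)) -> (forall x c, I x -> I (star x c)) ->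
  is_ideal I.
Proof.
move=> sI nI lI tI; split=> //; split.
  split=> [|x y Ix Iy]; first exact: sI.1.
  rewrite -[_ * _]/(x ** binv y) bulE; apply: subgroupM => //.
  by apply: (lI); rewrite binvE; apply: subgroupV => //; apply: (lI).
move=> x y Ix; have -> : (x : adj A) ^ (y : adj A) = conjb (binv y) x.
  by rewrite /conjb binvK -bulA.
by rewrite conjbE; apply: (nI); apply: subgroupM => //; apply: (lI) => //; apply: (tI).
Qed.

Lemma star_subgroup_ideal : is_ideal star_subgroup.
Proof.
have sB := gen_subgroupP [set star a b | a in setT & b in setT].
have star_in a b : star_subgroup (star a b).
  by apply: mem_gen; exists a => //; exists b.
apply: ideal_crit => // [x y|a].
  apply: (@gen_morph A _ star_subgroup (fun z => z ^ y) _ sB) => [u v|_ [a _ [b _ <-]]].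
    exact: conjMg.
  have := starM a y^-1 b; rewrite invgK => /esym /(canRL (mulKg _)) ->.
  exact: (subgroupM sB (subgroupV sB (star_in _ _)) (star_in _ _)).
apply: (@gen_morph A _ star_subgroup _ (lamM a) sB) => _ [b _ [c _ <-]].
by rewrite lam_starJ.
Qed.

End SkewBraceTheory.

Arguments star_subgroup A : clear implicits.
Arguments ker_lam A : clear implicits.
Arguments Fix_lam A : clear implicits.
Arguments Ann A : clear implicits.
Arguments trivial_skew_brace A : clear implicits.
Arguments is_brace A : clear implicits.

Record ideal (A : skewBraceType) := Ideal {
  ideal_set :> set A;
  idealP : is_ideal ideal_set
}.

Section IdealTheory.
Variables (A : skewBraceType).
Implicit Types (a b c x y : A) (I J : ideal A).

Lemma ideal_sub I : subgroup_set I. Proof. by case: (idealP I) => [[]]. Qed.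

Lemma ideal1 I : ideal_set I 1. Proof. by case: (ideal_sub I). Qed.

Lemma idealV I x : ideal_set I x -> ideal_set I x^-1.
Proof. exact: (subgroupV (ideal_sub I)). Qed.

Lemma idealM I x y : ideal_set I x -> ideal_set I y -> ideal_set I (x * y).
Proof. exact: (subgroupM (ideal_sub I)). Qed.

Lemma idealJ I x y : ideal_set I x -> ideal_set I (x ^ y).
Proof. by case: (idealP I) => [[_ n] _ _]; apply: n. Qed.

Lemma ideal_lam I a x : ideal_set I x -> ideal_set I (lam a x).
Proof. by case: (idealP I) => _ _ lI; apply: lI. Qed.

Lemma ideal_star I x c : ideal_set I x -> ideal_set I (star x c).
Proof.
case: (idealP I) => _ [_ nI] _ Ix.
have Ix' : ideal_set I (binv c ** (x ** c)) by exact: (nI x c Ix).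
have -> : star x c = x^-1 * (lam c (binv c ** (x ** c))) ^ c^-1.
  rewrite conjgE invgK [c * (_ / _)]mulgA -bulE bulA bulgV bul1g.
  by rewrite /star mulgA.
by apply: idealM; [apply: idealV | apply: idealJ; apply: ideal_lam].
Qed.

Lemma idealI_ideal I J : is_ideal (I `&` J).
Proof.
apply: ideal_crit => [|x y [? ?]|a x [? ?]|x c [? ?]].
- split=> [|x y [? ?] [? ?]]; first by split; apply: ideal1.
  by split; apply: idealM => //; apply: idealV.
- by split; apply: idealJ.
- by split; apply: ideal_lam.
- by split; apply: ideal_star.
Qed.

Definition prod_set I J : set A := [set b * d | b in I & d in J].

Lemma ideal_prod_ideal I J : is_ideal (prod_set I J).
Proof.
have inP b d x : ideal_set I b -> ideal_set J d -> b * d = x -> prod_set I J x.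
  by move=> Ib Jd <-; exists b => //; exists d.
apply: ideal_crit.
- split=> [|_ _ [b Ib [d Jd <-]] [b' Ib' [d' Jd' <-]]].
    by apply: (inP 1 1); rewrite ?mulg1 //; apply: ideal1.
  apply: (inP (b * b'^-1) ((d * d'^-1) ^ b'^-1)).
  + by apply: idealM => //; apply: idealV.
  + by apply: idealJ; apply: idealM => //; apply: idealV.
  + by rewrite conjgE invgK invgM !mulgA mulgVK.
- move=> _ y [b Ib [d Jd <-]]; apply: (inP (b ^ y) (d ^ y)); rewrite ?conjMg //;
  exact: idealJ.
- move=> a _ [b Ib [d Jd <-]]; apply: (inP (lam a b) (lam a d)); rewrite ?lamM //;
  exact: ideal_lam.
- move=> _ c [b Ib [d Jd <-]].
  pose d' := lam (binv b) d; have Jd' : ideal_set J d' by apply: ideal_lam.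
  apply: (inP (star b c) (lam b (star d' c) ^ (star b c))).
  + exact: ideal_star.
  + by apply: idealJ; apply: ideal_lam; apply: ideal_star.
  + rewrite -[d in RHS](lamVK b) -bulE -/d' [RHS]starE lamB [lam d' c]lam_star.
    by rewrite lamM conjgE mulVKg [star b c]starE mulgA.
Qed.

End IdealTheory.

Definition star_ideal (A : skewBraceType) : ideal A :=
  Ideal (@star_subgroup_ideal A).

Definition inter_ideal (A : skewBraceType) (I J : ideal A) : ideal A :=
  Ideal (idealI_ideal I J).

Definition prod_ideal (A : skewBraceType) (I J : ideal A) : ideal A :=
  Ideal (ideal_prod_ideal I J).

Section Quotient.
Variables (A : skewBraceType) (I : ideal A).
Implicit Types (a b c x y : A).

Definition ideal_rel : rel A := fun x y => `[< ideal_set I (x^-1 * y) >].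

Lemma ideal_rel_refl : reflexive ideal_rel.
Proof. by move=> x; apply/asboolP; rewrite mulVg; apply: ideal1. Qed.

Lemma ideal_rel_sym : symmetric ideal_rel.
Proof.
by move=> x y; apply/asboolP/asboolP => /idealV; rewrite invgM invgK.
Qed.

Lemma ideal_rel_trans : transitive ideal_rel.
Proof.
move=> y x z /asboolP Ixy /asboolP Iyz; apply/asboolP.
by have := idealM Ixy Iyz; rewrite mulgA mulgK.
Qed.

Canonical ideal_equiv :=
  EquivRel ideal_rel ideal_rel_refl ideal_rel_sym ideal_rel_trans.

Definition quot : Type := {eq_quot ideal_equiv}.

HB.instance Definition _ := Choice.on quot.
HB.instance Definition _ := EqQuotient.on quot.

Definition coset (a : A) : quot := \pi_quot a.

Lemma cosetP x y : reflect (ideal_set I (x^-1 * y)) (coset x == coset y).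
Proof. by rewrite /coset eqquotE; apply: asboolP. Qed.

Lemma coset_eqP x y : coset x = coset y <-> ideal_set I (x^-1 * y).
Proof. by split=> [/eqP/cosetP|/cosetP/eqP]. Qed.

Lemma coset_repr (q : quot) : coset (repr q) = q.
Proof. exact: reprK. Qed.

Lemma coset_mulr x z : ideal_set I z -> coset (x * z) = coset x.
Proof. by move=> Iz; apply/esym/coset_eqP; rewrite mulKg. Qed.

Lemma coset_mull x z : ideal_set I z -> coset (z * x) = coset x.
Proof. by move=> Iz; rewrite conjgC coset_mulr //; apply: idealJ. Qed.

Lemma coset_repr_mul x : exists2 z, ideal_set I z & repr (coset x) = x * z.
Proof.
exists (x^-1 * repr (coset x)); last by rewrite mulVKg.
by apply/coset_eqP; rewrite coset_repr.
Qed.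

Definition quot_mul (p q : quot) : quot := coset (repr p * repr q).
Definition quot_inv (p : quot) : quot := coset (repr p)^-1.
Definition quot_bul (p q : quot) : quot := coset (repr p ** repr q).
Definition quot_binv (p : quot) : quot := coset (binv (repr p)).

Lemma quot_mulE x y : quot_mul (coset x) (coset y) = coset (x * y).
Proof.
rewrite /quot_mul; have [z Iz ->] := coset_repr_mul x.
have [t It ->] := coset_repr_mul y.
rewrite mulgA (coset_mulr _ It) -mulgA (conjgC z) mulgA.
exact: coset_mulr (idealJ y Iz).
Qed.

Lemma quot_invE x : quot_inv (coset x) = coset x^-1.
Proof.
rewrite /quot_inv; have [z Iz ->] := coset_repr_mul x.
by rewrite invgM coset_mull //; apply: idealV.
Qed.

Lemma quot_bulE x y : quot_bul (coset x) (coset y) = coset (x ** y).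
Proof.
rewrite /quot_bul; have [z Iz ->] := coset_repr_mul x.
have [t It ->] := coset_repr_mul y.
have bulr u v w : ideal_set I w -> coset (u ** (v * w)) = coset (u ** v).
  move=> Iw; rewrite bulE lamM mulgA -bulE.
  exact: coset_mulr (ideal_lam u Iw).
rewrite bulr // -[z](lamVK x) -bulE -bulA.
set z' := lam _ _; have Iz' : ideal_set I z' by apply: ideal_lam.
rewrite [z' ** y]bulE lam_star mulgA.
rewrite conjgC; apply: (bulr x y); apply/idealJ/idealM => //.
exact: ideal_star.
Qed.

Fact quot_mulA : associative quot_mul.
Proof.
move=> p q r; rewrite -(coset_repr p) -(coset_repr q) -(coset_repr r).
by rewrite !quot_mulE mulgA.
Qed.
Fact quot_mul1g : left_id (coset 1) quot_mul.
Proof. by move=> p; rewrite -(coset_repr p) quot_mulE mul1g. Qed.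
Fact quot_mulg1 : right_id (coset 1) quot_mul.
Proof. by move=> p; rewrite -(coset_repr p) quot_mulE mulg1. Qed.
Fact quot_mulVg : left_inverse (coset 1) quot_inv quot_mul.
Proof. by move=> p; rewrite -(coset_repr p) quot_invE quot_mulE mulVg. Qed.
Fact quot_mulgV : right_inverse (coset 1) quot_inv quot_mul.
Proof. by move=> p; rewrite -(coset_repr p) quot_invE quot_mulE mulgV. Qed.

HB.instance Definition _ :=
  isGroup.Build quot quot_mulA quot_mul1g quot_mulg1 quot_mulVg quot_mulgV.

Fact quot_bulA : associative quot_bul.
Proof.
move=> p q r; rewrite -(coset_repr p) -(coset_repr q) -(coset_repr r).
by rewrite !quot_bulE bulA.
Qed.
Fact quot_bul1g : left_id (1 : quot) quot_bul.
Proof. by move=> p; rewrite -(coset_repr p) quot_bulE bul1g. Qed.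
Fact quot_bulg1 : right_id (1 : quot) quot_bul.
Proof. by move=> p; rewrite -(coset_repr p) quot_bulE bulg1. Qed.
Fact quot_bulVg : left_inverse (1 : quot) quot_binv quot_bul.
Proof. by move=> p; rewrite -{2}(coset_repr p) quot_bulE bulVg. Qed.
Fact quot_bulgV : right_inverse (1 : quot) quot_binv quot_bul.
Proof. by move=> p; rewrite -{1}(coset_repr p) quot_bulE bulgV. Qed.
Fact quot_bulM (p q r : quot) :
  quot_bul p (q * r) = quot_bul p q * p^-1 * quot_bul p r.
Proof.
rewrite -(coset_repr p) -(coset_repr q) -(coset_repr r).
rewrite -[_ * coset (repr r)]/(quot_mul _ _) quot_mulE !quot_bulE.
by rewrite bulM -!quot_mulE -quot_invE.
Qed.

HB.instance Definition _ := isSkewBrace.Build quot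
  quot_bulA quot_bul1g quot_bulg1 quot_bulVg quot_bulgV quot_bulM.

Fact coset_mul : {morph coset : x y / x * y}.
Proof. by move=> x y; rewrite -quot_mulE. Qed.
Fact coset_bul : {morph coset : x y / x ** y}.
Proof. by move=> x y; rewrite -quot_bulE. Qed.

HB.instance Definition _ := isMultiplicative.Build A quot coset coset_mul.
HB.instance Definition _ := isBulMultiplicative.Build A quot coset coset_bul.

Lemma coset_inv x : coset x^-1 = (coset x)^-1.
Proof. by rewrite -quot_invE. Qed.

Lemma coset_lam x y : coset (lam x y) = lam (coset x) (coset y).
Proof. by rewrite /lam coset_mul coset_inv coset_bul. Qed.

Lemma coset_star x y : coset (star x y) = star (coset x) (coset y).
Proof. by rewrite starE coset_mul coset_inv coset_lam. Qed.

End Quotient.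

Section QuotientMap.
Variables (A : skewBraceType) (I J : ideal A) (sIJ : I `<=` J).

Definition quot_map of I `<=` J : quot I -> quot J :=
  fun p => coset J (repr p).

Local Notation q := (quot_map sIJ).

Lemma quot_mapE x : q (coset I x) = coset J x.
Proof.
rewrite /quot_map; have [z Iz ->] := coset_repr_mul I x.
by rewrite coset_mulr //; apply: sIJ.
Qed.

Fact quot_map_mul : {morph q : x y / x * y}.
Proof.
move=> p r; rewrite -(coset_repr p) -(coset_repr r).
by rewrite -coset_mul !quot_mapE coset_mul.
Qed.
Fact quot_map_bul : {morph q : x y / x ** y}.
Proof.
move=> p r; rewrite -(coset_repr p) -(coset_repr r).
by rewrite -coset_bul !quot_mapE coset_bul.
Qed.

HB.instance Definition _ := isMultiplicative.Build (quot I) (quot J) q quot_map_mul.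
HB.instance Definition _ := isBulMultiplicative.Build (quot I) (quot J) q quot_map_bul.

End QuotientMap.

Section DirectProduct.
Variables A B : skewBraceType.
Local Notation AB := (A * B)%type.

Definition bul_pair (x y : AB) : AB := (x.1 ** y.1, x.2 ** y.2).
Definition binv_pair (x : AB) : AB := (binv x.1, binv x.2).

Fact bul_pairA : associative bul_pair.
Proof. by move=> x y z; congr (_, _); apply: bulA. Qed.
Fact bul_pair1g : left_id 1 bul_pair.
Proof. by move=> [x y]; congr (_, _); apply: bul1g. Qed.
Fact bul_pairg1 : right_id 1 bul_pair.
Proof. by move=> [x y]; congr (_, _); apply: bulg1. Qed.
Fact bul_pairVg : left_inverse 1 binv_pair bul_pair.
Proof. by move=> x; congr (_, _); apply: bulVg. Qed.
Fact bul_pairgV : right_inverse 1 binv_pair bul_pair.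
Proof. by move=> x; congr (_, _); apply: bulgV. Qed.
Fact bul_pairM (x y z : AB) :
  bul_pair x (y * z) = bul_pair x y * x^-1 * bul_pair x z.
Proof. by congr (_, _); apply: bulM. Qed.

HB.instance Definition _ := isSkewBrace.Build AB
  bul_pairA bul_pair1g bul_pairg1 bul_pairVg bul_pairgV bul_pairM.

End DirectProduct.

Section MorphismTheory.
Variables (A B : skewBraceType) (f : {skewbrace A -> B}).

Lemma skb_morph1 : f 1 = 1.
Proof. by apply: (@mulgI _ (f 1)); rewrite -gmulfM !mulg1. Qed.

Lemma skb_morphV x : f x^-1 = (f x)^-1.
Proof. by apply/esym/mulg1_eq; rewrite -gmulfM mulgV; apply: skb_morph1. Qed.

Lemma skb_morphF x y : f (x * y^-1) = f x * (f y)^-1.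
Proof. by rewrite -skb_morphV; apply: gmulfM. Qed.

Lemma skb_morphB x y : f (x ** y) = f x ** f y.
Proof. exact: gmulfB. Qed.

Lemma skb_morphBV x : f (binv x) = binv (f x).
Proof.
have e : f (binv x) ** f x = 1 by rewrite -gmulfB bulVg; apply: skb_morph1.
by rewrite -[LHS]bulg1 -(bulgV (f x)) bulA e bul1g.
Qed.

Definition ker : set A := [set x | f x = 1].

Definition central_extension :=
  (forall y, exists x, f x = y) /\ ker `<=` Ann A.

End MorphismTheory.

Section FibreProduct.
Variables (T R C : skewBraceType).
Variables (f : {skewbrace T -> C}) (g : {skewbrace R -> C}).

Definition fibre_pred : {pred T * R} := fun p => f p.1 == g p.2.

Record fibre_product : Type := FibreProduct {
  fibre_val : T * R;
  fibre_valP : fibre_val \in fibre_pred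
}.

HB.instance Definition _ := [isSub for fibre_val].
HB.instance Definition _ := [Choice of fibre_product by <:].

Fact fibre_group_closed : group_closed fibre_pred.
Proof.
split=> [|p q]; rewrite !unfold_in.
  exact/eqP/(etrans (skb_morph1 f) (esym (skb_morph1 g))).
move=> /eqP fgp /eqP fgq; by rewrite /fibre_pred /= !skb_morphF fgp fgq.
Qed.

HB.instance Definition _ :=
  SubChoice_isSubGroup.Build (T * R)%type fibre_pred fibre_product
    fibre_group_closed.

Fact fibre_bulP (p q : fibre_product) : val p ** val q \in fibre_pred.
Proof.
have := fibre_valP p; have := fibre_valP q; rewrite !unfold_in.
by move=> /eqP fgq /eqP fgp; rewrite /fibre_pred /= !skb_morphB fgp fgq.
Qed.
Fact fibre_binvP (p : fibre_product) : binv (val p) \in fibre_pred.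
Proof.
have := fibre_valP p; rewrite !unfold_in.
by move=> /eqP fgp; rewrite /fibre_pred /= !skb_morphBV fgp.
Qed.

Definition fibre_bul (p q : fibre_product) : fibre_product :=
  FibreProduct (fibre_bulP p q).
Definition fibre_binv (p : fibre_product) : fibre_product :=
  FibreProduct (fibre_binvP p).

Fact fibre_bulA : associative fibre_bul.
Proof. by move=> p q r; apply/val_inj/bulA. Qed.
Fact fibre_bul1g : left_id 1 fibre_bul.
Proof. by move=> p; apply/val_inj/bul1g. Qed.
Fact fibre_bulg1 : right_id 1 fibre_bul.
Proof. by move=> p; apply/val_inj/bulg1. Qed.
Fact fibre_bulVg : left_inverse 1 fibre_binv fibre_bul.
Proof. by move=> p; apply/val_inj/bulVg. Qed.
Fact fibre_bulgV : right_inverse 1 fibre_binv fibre_bul.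
Proof. by move=> p; apply/val_inj/bulgV. Qed.
Fact fibre_bulM (p q r : fibre_product) :
  fibre_bul p (q * r) = fibre_bul p q * p^-1 * fibre_bul p r.
Proof. by apply/val_inj/bulM. Qed.

HB.instance Definition _ := isSkewBrace.Build fibre_product
  fibre_bulA fibre_bul1g fibre_bulg1 fibre_bulVg fibre_bulgV fibre_bulM.

End FibreProduct.

Section TwoSided.
Variable A : twoSidedSkewBraceType.
Implicit Types (a b c x y : A).

Lemma commutator_subgroup_ideal : @is_ideal A (commutator_subgroup A).
Proof.
have sD := gen_subgroupP [set [~ x, y] | x in setT & y in setT] : subgroup_set
  (commutator_subgroup A).
have fD (f : A -> A) : {morph f : x y / x * y} ->
    forall x, commutator_subgroup A x -> commutator_subgroup A (f x).
  move=> fM; apply: (gen_morph fM) => // _ [x _ [y _ <-]].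
  have f1 : f 1 = 1 by apply: (@mulgI _ (f 1)); rewrite -fM !mulg1.
  have fV z : f z^-1 = (f z)^-1 by apply/esym/mulg1_eq; rewrite -fM mulgV.
  by apply: mem_gen; exists (f x) => //; exists (f y) => //;
     rewrite /commg /conjg !fM !fV.
apply: ideal_crit => // [x y|a x|x c Dx].
- by apply: (fD (fun z => z ^ y)) => u v; apply: conjMg.
- by apply: fD; apply: lamM.
- rewrite /star -mulgA; apply: (subgroupM sD) => //; first exact: (subgroupV sD).
  by apply: (fD (fun z => z ** c * c^-1)) => // u v /=; rewrite bulMl !mulgA.
Qed.

Definition commutator_ideal : ideal A := Ideal commutator_subgroup_ideal.

End TwoSided.

(* Non-unital radical rings: every element has a two-sided inverse for the
   circle operation r + s + rs. *)
HB.mixin Record isRadicalRing R of GRing.Zmodule R := {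
  rmul : R -> R -> R;
  rmulA : associative rmul;
  rmulDl : left_distributive rmul +%R;
  rmulDr : right_distributive rmul +%R;
  rmul_qinv : forall r : R, exists s : R,
    (r + s + rmul r s = 0 /\ s + r + rmul s r = 0)%R
}.

#[short(type="radicalRingType")]
HB.structure Definition RadicalRing := {R of isRadicalRing R & GRing.Zmodule R}.

Definition ring_square (R : radicalRingType) : set R :=
  smallest [set S : set R | S 0%R /\ forall x y, S x -> S y -> S (x - y)%R]
           [set rmul r s | r in setT & s in setT].

Arguments ring_square R : clear implicits.

(* $R = A/D$, both as a skew brace and as a radical ring on the same carrier. *)
Definition radring (A : twoSidedSkewBraceType) : Type :=
  quot (commutator_ideal A).

Section RadRing.
Variable A : twoSidedSkewBraceType.
Local Notation R := (radring A).
Local Notation cos := (coset (commutator_ideal A)).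

HB.instance Definition _ := SkewBrace.on R.

Fact radring_mulC : commutative (@mul R).
Proof.
move=> r s; rewrite -(coset_repr r) -(coset_repr s) -!coset_mul.
apply/coset_eqP.
have -> : (repr r * repr s)^-1 * (repr s * repr r) = [~ repr s, repr r].
  by rewrite /commg /conjg invgM !mulgA.
apply: (@mem_gen A [set [~ x, y] | x in setT & y in setT]).
by exists (repr s) => //; exists (repr r).
Qed.

HB.instance Definition _ := GRing.isZmodule.Build R
  (@mulgA R) radring_mulC (@mul1g R) (@mulVg R).

Lemma radring_addE (r s : R) : (r + s)%R = (r * s)%g. Proof. by []. Qed.

Definition radring_mul (r s : R) : R := cos (star (repr r) (repr s)).

Lemma radring_mul_star (r s : R) : radring_mul r s = star r s.
Proof. by rewrite /radring_mul coset_star !coset_repr. Qed.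

Lemma radring_mul_coset (a b : A) :
  radring_mul (cos a) (cos b) = cos (star a b).
Proof. by rewrite radring_mul_star coset_star. Qed.

Lemma radring_bul (r s : R) : r ** s = (r + s + radring_mul r s)%R.
Proof.
have -> : r ** s = (r + lam r s)%R by rewrite bulE.
have -> : radring_mul r s = (lam r s - s)%R by rewrite radring_mul_star.
by rewrite -addrA [(s + _)%R]addrC subrK.
Qed.

Fact radring_mulDr : right_distributive radring_mul +%R.
Proof.
move=> r s t; rewrite !radring_mul_star starM radring_addE; congr (_ * _).
by rewrite conjgE [star r t * _]radring_mulC mulKg.
Qed.

Fact radring_mulDl : left_distributive radring_mul +%R.
Proof.
move=> r s t; rewrite -(coset_repr r) -(coset_repr s) -(coset_repr t).
rewrite radring_addE -coset_mul !radring_mul_coset radring_addE -coset_mul.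
set a := repr r; set b := repr s; set c := repr t.
have -> : star (a * b) c = (star a c) ^ b * star b c.
  by rewrite /star bulMl conjgE invgM !mulgA mulgK.
rewrite [LHS]coset_mul [RHS]coset_mul; congr (_ * _).
rewrite conjgE [LHS]coset_mul coset_inv [X in _ * X]coset_mul.
by rewrite [X in _ * X]radring_mulC mulKg.
Qed.

Fact radring_mulA : associative radring_mul.
Proof.
move=> r s t; have := bulA r s t; rewrite !radring_bul !(radring_mulDl, radring_mulDr).
rewrite -!addrA => /(@addrI R r _ _) /(@addrI R s _ _).
rewrite [RHS]addrCA => /(@addrI R t _ _).
rewrite [LHS]addrCA => /(@addrI R _ _ _).
by rewrite [LHS]addrCA => /(@addrI R _ _ _) /(@addrI R _ _ _).
Qed.

Fact radring_qinv (r : R) : exists s : R,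
  (r + s + radring_mul r s = 0 /\ s + r + radring_mul s r = 0)%R.
Proof. by exists (binv r); rewrite -!radring_bul bulgV bulVg. Qed.

HB.instance Definition _ := isRadicalRing.Build R
  radring_mulA radring_mulDl radring_mulDr radring_qinv.

Lemma ring_square_star : ring_square R = star_subgroup R.
Proof.
rewrite /star_subgroup /gen_subgroup /ring_square; congr (smallest _ _).
rewrite eqEsubset; split=> _ [r _ [s _ <-]]; exists r => //; exists s => //.
  by rewrite -radring_mul_star.
exact: radring_mul_star.
Qed.

Lemma ring_square_is_ideal : @is_ideal R (ring_square R).
Proof. by rewrite ring_square_star; apply: star_subgroup_ideal. Qed.

Definition ring_square_ideal : ideal R := Ideal ring_square_is_ideal.

End RadRing.

Section Subsets.
Variables (A : skewBraceType) (I J : ideal A).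

Lemma sub_prodl : I `<=` prod_ideal I J.
Proof. by move=> x Ix; exists x => //; exists 1; [exact: ideal1 | rewrite mulg1]. Qed.

Lemma sub_prodr : J `<=` prod_ideal I J.
Proof. by move=> x Jx; exists 1; [exact: ideal1 | exists x; rewrite ?mul1g]. Qed.

End Subsets.

(* Main.v *)
Require Import Defs.
From HB Require Import structures.
From mathcomp Require Import all_boot ssralg.
From mathcomp Require Import boolp classical_sets.

Set Implicit Arguments.
Unset Strict Implicit.
Unset Printing Implicit Defensive.

Local Open Scope classical_set_scope.
Local Open Scope group_scope.

(** Everything rests on one fact: if the star product of a two-sided skew
    brace A is associative, then B = A * A is central in (A, .)
    ([star_subgroup_central]).  Granting it, the laws for star of a product
    lose their conjugations, so that star is a morphism in each argument with
    values in an abelian group; hence it kills the commutator subgroup D on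
    either side.  An element of B meet D is then central, acts trivially under
    lambda and is fixed by lambda: it lies in the annihilator
    ([inter_ideal_Ann]).

    Centrality of B takes three steps.

    - Expanding (a.b) * (c.d) with left and right distributivity in the two
      possible orders shows that b o c and c.b act in the same way on B by
      conjugation ([bul_twist_centralizer]), where o is the second operation.
      Thus the centraliser Z of B is an ideal, and in A / Z the star product
      a * b is the commutator [a, b^-1].  A group in which that operation is
      associative is 2-Engel, and even of class two, since its triple
      commutators are killed by 2 and, by the Hall-Witt identity, by 3
      ([assoc_commutator_class2]).  So triple star products centralise B
      ([star_star_centralizer]).

    - Expanding a * (b * (c.d)) = (a * b) * (c.d), where the triple star
      products now commute with B and cancel, leaves a commutation relation
      between arbitrary star products: B is abelian ([star_centralizer]).

    - Now that B is abelian, the two expansions of (a o b) * c differ only by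
      a conjugation by b of the element a * lambda_b(c), which therefore
      commutes with b ([star_lam_commute]).  As lambda_b is onto, every star
      product commutes with every b.

    The rest holds for more general ideals.  For ideals I and J of a skew brace,
    A / (I meet J) is always the fibre product of A / I and A / J over A / IJ,
    by the first isomorphism theorem ([pair_coset_fibre]); and the star
    subgroup of A / J is the image of that of A, so that C is the quotient of R by
    its square ([star_subgroup_coset]). *)

(** * Groups in which a commutator operation is associative *)

(** Rewrites a word to its reduced form in the free group, which decides the
    identities that hold in all groups. *)
Definition group_simp (G : groupType) :=
  (@conjgE G, @invgM G, @invgK G, @mulgA G, @mulgK G, @mulgVK G,
   @mulVg G, @mulgV G, @mulg1 G, @mul1g G, @invg1 G).

Lemma Hall_Witt (G : groupType) (x y z : G) :
  [~ x, y^-1, z] ^ y * [~ y, z^-1, x] ^ z * [~ z, x^-1, y] ^ x = 1.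
Proof. by rewrite /commg !group_simp. Qed.

Lemma commgV_Engel (G : groupType) (a b : G) :
  commute [~ a, b] b -> [~ a, b^-1] = [~ a, b]^-1.
Proof.
move=> cab; apply/esym/mulg1_eq.
have <- : [~ a, b] * [~ a, b^-1] ^ b = 1 by rewrite /commg !group_simp.
congr (_ * _); apply/esym/conjg_fixP/commgP.
have -> : [~ a, b^-1] = ([~ a, b] ^ b^-1)^-1 by rewrite /commg !group_simp.
suff -> : [~ a, b] ^ b^-1 = [~ a, b] by apply/commute_sym/commuteV/commute_sym.
exact/conjg_fixP/commgP/commuteV.
Qed.

(** Associativity with equal second and third entries is the 2-Engel condition.
    Signs can then be pulled out of commutators, and associativity says that a
    triple commutator is inverted by a cyclic shift of its entries; three
    shifts show that it is its own inverse.  It is therefore invariant under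
    cyclic shifts, so that the Hall-Witt identity says that its cube is
    trivial as well. *)
Lemma assoc_commutator_class2 (G : groupType) :
  associative (fun a b : G => [~ a, b^-1]) ->
  forall a b c : G, [~ a, b, c] = 1.
Proof.
move=> assoc.
have engel (a b : G) : commute [~ a, b] b.
  apply/commgP/eqP; have := assoc a b^-1 b^-1.
  have bb1 : [~ b^-1, b] = 1 by rewrite /commg !group_simp.
  by rewrite /= invgK bb1 invg1 commg1.
have commgV (a b : G) : [~ a, b^-1] = [~ a, b]^-1 by exact: commgV_Engel.
have commVg (a b : G) : [~ a^-1, b] = [~ a, b]^-1 by rewrite -invgR commgV !invgR.
have cyc (a b c : G) : [~ a, b, c] = [~ b, c, a]^-1.
  have := assoc a b c; rewrite /= !commgV !invgK commVg invgK => <-.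
  by rewrite invgR.
have sq (a b c : G) : [~ a, b, c]^-1 = [~ a, b, c]
  by do 3! rewrite [in LHS]cyc; rewrite !invgK.
have cycE (a b c : G) : [~ a, b, c] = [~ b, c, a] by rewrite cyc sq.
(* The Engel condition applies to the cyclic shift [z, x, y]: this removes the
   conjugations from the Hall-Witt identity. *)
move=> a b c; have fixT (x y z : G) : [~ x, y^-1, z] ^ y = [~ x, y, z].
  rewrite commgV commVg sq; apply/conjg_fixP/commgP.
  have -> : [~ x, y, z] = [~ z, x, y] by rewrite -cycE.
  exact: engel.
have := Hall_Witt a b c; rewrite !fixT.
by rewrite -(cycE b c a) -(cycE a b c) -[X in X * _ * _]sq mulVg mul1g.
Qed.

(** * The centraliser of the star subgroup *)

(** The right-handed counterpart of [starM]. *)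
Lemma starMl (A : twoSidedSkewBraceType) (a b c : A) :
  star (a * b) c = (star a c) ^ b * star b c.
Proof. by rewrite /star bulMl !group_simp. Qed.

Lemma star_bul (A : skewBraceType) (a b c : A) :
  star (a ** b) c = star a (lam b c) * star b c.
Proof. by rewrite !starE lamB -[RHS]mulgA mulKg. Qed.

(** Writing lam a c = star a c * c, its factor c moves inside as a conjugation
    by c^-1, so that star a (star b d ^ c^-1) can be compared with the factor
    star a (star b d) ^ c^-1 that [starM] produces. *)
Lemma star_conjV (A : skewBraceType) (a t c : A) :
  star a (t ^ c^-1) =
    star a c * (star a t ^ c^-1 * t ^ c^-1) * (star a c)^-1 * (t ^ c^-1)^-1.
Proof.
rewrite starE [t ^ _ in LHS]conjgE invgK !lamM lamV.
by rewrite /star /lam !group_simp.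
Qed.

Lemma star_mem (A : skewBraceType) (a b : A) : star_subgroup A (star a b).
Proof. by apply: mem_gen; exists a => //; exists b. Qed.

Definition centralizer (G : groupType) (S : set G) : set G :=
  [set z | forall x, S x -> commute z x].

Lemma centralizer_subgroup (G : groupType) (S : set G) :
  subgroup_set (centralizer S).
Proof.
split=> [x _|x y Cx Cy z Sz]; first exact/commute_sym/commute1.
by apply: commute_sym; apply: commuteM; [|apply: commuteV];
  apply: commute_sym; [apply: Cx | apply: Cy].
Qed.

Lemma centralizer_gen (G : groupType) (S : set G) :
  centralizer (gen_subgroup S) = centralizer S.
Proof.
rewrite eqEsubset; split=> z Cz x Sx; first by apply: Cz; apply: mem_gen.
apply: (Sx [set y | commute z y]); split=> //; split=> [|y t /= zy zt].
  exact: commute1.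
by apply: commuteM => //; apply: commuteV.
Qed.

Lemma centralizer_star (A : skewBraceType) (z : A) :
  (forall a b, commute z (star a b)) -> centralizer (star_ideal A) z.
Proof. by move=> Cz; rewrite /= centralizer_gen => _ [a _ [b _ <-]]. Qed.

(** Expanding star (a * b) (c * d) first in its left or first in its right
    argument gives the equation E of the proof, by which b ** c and c * b
    conjugate star a d to the same element. *)
Lemma bul_twist_centralizer (A : twoSidedSkewBraceType) (b c : A) :
  centralizer (star_ideal A) (c^-1 * (b ** c) * b^-1).
Proof.
apply: centralizer_star => a d.
have E : (star a d ^ c^-1) ^ b * star b c = star b c * (star a d ^ b) ^ c^-1.
  apply: (@mulgI _ ((star a c) ^ b)); apply: (@mulIg _ ((star b d) ^ c^-1)).
  have := starM (a * b) c d; rewrite !starMl !starM.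
  by rewrite /star !group_simp.
move: (star a d) E => x /(congr1 (fun t => c^-1 * b * t * c * b^-1)).
by rewrite /star /commute !group_simp => ->.
Qed.

(** Since z centralises B, so does star z c: by [bul_twist_centralizer] it is a
    product of conjugates of elements that do. *)
Lemma centralizer_star_ideal (A : twoSidedSkewBraceType) :
  is_ideal (centralizer (star_ideal A)).
Proof.
have sC := centralizer_subgroup (star_ideal A).
have nC z y : centralizer (star_ideal A) z -> centralizer (star_ideal A) (z ^ y).
  move=> Cz x Bx; rewrite -[x](conjgKV y) /commute -!conjMg; congr (_ ^ _).
  exact/Cz/idealJ.
apply: ideal_crit => // [a z Cz x Bx|z c Cz].
  rewrite -[x](lamVK a) /commute -!lamM; congr (lam a _).
  exact/Cz/ideal_lam.
have -> : star z c = z^-1 * (c^-1 * (z ** c) * z^-1 * z) ^ c^-1.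
  by rewrite /star !group_simp.
apply: (subgroupM sC); first exact: (subgroupV sC).
by apply/nC/(subgroupM sC) => //; apply: bul_twist_centralizer.
Qed.

Definition centralizer_ideal (A : twoSidedSkewBraceType) : ideal A :=
  Ideal (@centralizer_star_ideal A).

Lemma coset1P (A : skewBraceType) (I : ideal A) (x : A) :
  coset I x = 1 <-> ideal_set I x.
Proof.
have -> : (1 : quot I) = coset I 1 by [].
by split=> [/esym/coset_eqP|Ix]; [|apply/esym/coset_eqP]; rewrite invg1 mul1g.
Qed.

(** Modulo the centraliser of B, ** is the opposite of the product. *)
Lemma coset_centralizer_star (A : twoSidedSkewBraceType)
    (p q : quot (centralizer_ideal A)) :
  star p q = [~ p, q^-1].
Proof.
rewrite -(coset_repr p) -(coset_repr q); set b := repr p; set c := repr q.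
have := (coset1P (centralizer_ideal A) _).2 (bul_twist_centralizer b c).
rewrite !coset_mul !coset_inv coset_bul => E.
have -> : [~ coset _ b, (coset (centralizer_ideal A) c)^-1] =
  (coset _ b)^-1 * (coset _ c * coset _ b) * (coset _ c)^-1.
  by rewrite /commg !group_simp.
rewrite /star; congr (_ * _ * _).
rewrite -[RHS]mulg1 -mulgA.
move: E => /(congr1 (fun t => coset _ c * t * coset _ b)).
by rewrite !group_simp => ->.
Qed.

(** In the quotient by the centraliser of B, a triple star product is a triple
    commutator, and associativity forces it to vanish. *)
Lemma star_star_centralizer (A : twoSidedSkewBraceType)
    (star_assoc : associative (@star A)) (a b c : A) :
  centralizer (star_ideal A) (star a (star b c)).
Proof.
apply: (coset1P (centralizer_ideal A) _).1; rewrite star_assoc !coset_star.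
rewrite !coset_centralizer_star.
apply: assoc_commutator_class2 => p q r.
rewrite -!coset_centralizer_star -(coset_repr p) -(coset_repr q) -(coset_repr r).
by rewrite -!coset_star star_assoc.
Qed.

Lemma commutator_subgroup_ker (G H : groupType) (f : G -> H) :
  {morph f : x y / x * y} -> (forall x y, commute (f x) (f y)) ->
  forall x, commutator_subgroup G x -> f x = 1.
Proof.
move=> fM fC x Dx.
have f1 : f 1 = 1 by apply: (@mulgI _ (f 1)); rewrite -fM !mulg1.
apply: (Dx [set y | f y = 1]); split=> [|_ [y _ [z _ <-]] /=].
  split=> //= y z fy fz.
  by apply: (@mulIg _ (f z)); rewrite -fM mulgVK fy fz mulg1.
apply: (@mulgI _ (f z * f y)).
by rewrite mulg1 -!fM -commgC !fM; apply: fC.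
Qed.

Section StarAssociative.
Variables (A : twoSidedSkewBraceType) (star_assoc : associative (@star A)).
Implicit Types (a b c d x y z : A).

(** The star subgroup is abelian.  Cancelling the centralising triple products
    from star a (star b (c * d)) = star (star a b) (c * d) leaves the statement
    that star a c commutes with the conjugate by c^-1 of star b d. *)
Lemma star_centralizer a c : centralizer (star_ideal A) (star a c).
Proof.
(* Conjugating the relation by c frees the generator star b d. *)
suff Cu : centralizer (star_ideal A) (star a c ^ c).
  rewrite -[star a c](conjgK c).
  exact: (idealJ (I := centralizer_ideal A)) Cu.
apply: centralizer_star => b d.
set y := star b d; set u := star a c; set v := star b c.
have Cp : centralizer (star_ideal A) ((star a y) ^ c^-1).
  by apply: (idealJ (I := centralizer_ideal A)); apply: star_star_centralizer.
set Y := y ^ c^-1; set P := star a y ^ c^-1 in Cp.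
have aY : star a Y = u * (P * Y) * u^-1 * Y^-1 by exact: star_conjV.
have E : star a Y = P.
  have := star_assoc a b (c * d).
  rewrite (starM b c d) !(starM _ (star b c)) (starM _ c d) -!star_assoc.
  move=> /mulgI E; rewrite -[LHS](conjgKV v) E; apply/conjg_fixP/commgP.
  exact: Cp (star_mem b c).
have uP : u * P = P * u by apply: commute_sym; exact: Cp (star_mem a c).
have uY : u * Y = Y * u.
  move: E uP; rewrite aY; move: (P) (Y) (u) => p t w E up.
  apply: (@mulgI _ p); apply: (@mulIg _ w^-1); apply: (@mulIg _ t^-1).
  by rewrite [in LHS]mulgA -up !mulgA !mulgK -[RHS]E !mulgA.
by rewrite -[y](conjgKV c) /commute -!conjMg uY.
Qed.

(** As B is abelian, star a (lam b c) is the product of star a (star b c) and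
    star a c by [starM].  Reading star (a ** b) c as star (a * star a b * b) c
    and using associativity gives the conjugate by b of the same product. *)
Lemma star_lam_commute a b c : commute b (star a (lam b c)).
Proof.
have Bcom x y z t : star x y * star z t = star z t * star x y.
  exact: star_centralizer (star_mem z t).
have E1 : star a (lam b c) = star a (star b c) * star a c.
  rewrite [lam b c]lam_star starM; congr (_ * _).
  by apply/conjg_fixP/commgP/commuteV/Bcom.
have E2 : star a (lam b c) = (star a c * star a (star b c)) ^ b.
  apply: (@mulIg _ (star b c)); rewrite -star_bul.
  rewrite bulE [lam a b]lam_star mulgA (starMl _ b) (starMl a) -star_assoc.
  congr (_ ^ _ * _); congr (_ * _).
  exact/conjg_fixP/commgP/Bcom.
apply: commute_sym; apply/commgP/conjg_fixP.
by rewrite [in LHS]E1 -(Bcom a c) -E2.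
Qed.

Lemma star_commute b a c : commute b (star a c).
Proof. by rewrite -(lamVK b c); apply: star_lam_commute. Qed.

Lemma star_subgroup_central x : star_subgroup A x -> center_set A x.
Proof.
move=> Bx b; apply: commute_sym.
exact: (centralizer_star (star_commute b)) Bx.
Qed.

Lemma starDr a : {morph star a : b c / b * c}.
Proof.
move=> b c; rewrite starM; congr (_ * _).
exact/conjg_fixP/commgP/commute_sym/star_commute.
Qed.

Lemma starDl c : {morph (@star A)^~ c : a b / a * b}.
Proof.
move=> a b; rewrite starMl; congr (_ * _).
exact/conjg_fixP/commgP/commute_sym/star_commute.
Qed.

(** Membership in B gives centrality, membership in D the two conditions on
    lambda, since star is a morphism into the abelian B on each side. *)
Lemma inter_ideal_Ann :
  inter_ideal (star_ideal A) (commutator_ideal A) `<=` Ann A.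
Proof.
move=> x [Bx Dx]; have starC a b c d : commute (star a b) (star c d).
  exact/commute_sym/star_commute.
split; first split.
- exact: star_subgroup_central.
- move=> b; rewrite lam_star.
  by rewrite (commutator_subgroup_ker (starDl b)) ?mul1g // => y z.
- move=> a; rewrite lam_star.
  by rewrite (commutator_subgroup_ker (starDr a)) ?mul1g // => y z.
Qed.

End StarAssociative.

(** * Quotients by two ideals and their fibre product *)

Lemma morph_skewbrace (A B : skewBraceType) (f : A -> B) :
  {morph f : x y / x * y} -> {morph f : x y / x ** y} ->
  exists F : {skewbrace A -> B}, F =1 f.
Proof.
move=> fM fB.
pose mM := isMultiplicative.Build A B f fM.
pose mB := isBulMultiplicative.Build A B f fB.
pose F : {skewbrace A -> B} := HB.pack f mM mB.
by exists F.
Qed.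

Lemma first_isomorphism (A B : skewBraceType) (I : ideal A)
    (h : {skewbrace A -> B}) :
  (forall y, exists x, h x = y) -> ker h = I ->
  exists f : {skewbrace quot I -> B},
    bijective f /\ forall a, f (coset I a) = h a.
Proof.
move=> hsurj hker.
have hI z : ideal_set I z -> h z = 1 by rewrite -hker.
pose f (p : quot I) := h (repr p).
have fE a : f (coset I a) = h a.
  rewrite /f; have [z Iz ->] := coset_repr_mul I a.
  by rewrite gmulfM -[RHS]mulg1; congr (_ * _); apply: hI.
have fM : {morph f : p q / p * q}.
  move=> p q; rewrite -(coset_repr p) -(coset_repr q) -coset_mul !fE.
  exact: gmulfM.
have fB : {morph f : p q / p ** q}.
  move=> p q; rewrite -(coset_repr p) -(coset_repr q) -coset_bul !fE.
  exact: gmulfB.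
have [F FE] := morph_skewbrace fM fB; exists F; split=> [|a]; last by rewrite FE.
have [g gE] := choice hsurj.
exists (fun y => coset I (g y)) => [p|y]; rewrite FE ?fE //.
rewrite -(coset_repr p) fE; apply/coset_eqP.
rewrite -hker /ker /=.
have -> u v : h (u^-1 * v) = (h u)^-1 * h v by rewrite -skb_morphV; apply: gmulfM.
by rewrite gE mulVg.
Qed.

Lemma star_commutator_quot_trivial (A : twoSidedSkewBraceType) :
  let C := quot (prod_ideal (star_ideal A) (commutator_ideal A)) in
  is_brace C /\ trivial_skew_brace C.
Proof.
move=> C; split=> p q; rewrite -(coset_repr p) -(coset_repr q).
  rewrite -!coset_mul commgC [LHS]coset_mulr //.
  apply: (@sub_prodr A (star_ideal A) (commutator_ideal A)).
  by apply: mem_gen; exists (repr p) => //; exists (repr q).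
rewrite -coset_bul -coset_mul bulE lam_star (conjgC (star _ _)) mulgA.
rewrite [LHS]coset_mulr //.
apply: idealJ; apply: (@sub_prodl A (star_ideal A)); exact: star_mem.
Qed.

Lemma star_subgroup_quot (A : skewBraceType) (J : ideal A) :
  star_subgroup (quot J) = coset J @` star_subgroup A.
Proof.
have [B1 BF] := gen_subgroupP [set star a b | a in (@setT A) & b in (@setT A)].
rewrite eqEsubset; split=> [q Bq|_ [x Bx <-]].
  apply: (Bq (coset J @` star_subgroup A)); split; first split.
  - by exists 1.
  - move=> _ _ [x Bx <-] [y By <-]; exists (x * y^-1); first exact: BF.
    by rewrite coset_mul coset_inv.
  move=> _ [p _ [r _ <-]]; exists (star (repr p) (repr r)).
    exact: star_mem.
  by rewrite coset_star !coset_repr.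
apply: (Bx [set z | star_subgroup (quot J) (coset J z)]); split; first split.
- exact: (gen_subgroupP _).1.
- move=> y z By Bz; rewrite /= coset_mul coset_inv.
  exact: (gen_subgroupP _).2.
by move=> _ [a _ [b _ <-]]; rewrite /= coset_star; apply: star_mem.
Qed.

(** This identifies the kernel of A -> A / J -> (A / J) / (A / J)^2, where the
    square is the star subgroup. *)
Lemma star_subgroup_coset (A : skewBraceType) (J : ideal A) (x : A) :
  star_subgroup (quot J) (coset J x) <-> prod_set (star_ideal A) J x.
Proof.
rewrite star_subgroup_quot; split=> [[b Bb /coset_eqP Jbx]|[b Bb [d Jd <-]]].
  by exists b => //; exists (b^-1 * x); rewrite ?mulVKg.
by exists b => //; rewrite coset_mulr.
Qed.

(** Two cosets x I and y J with the same image modulo I J satisfy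
    x^-1 * y = b * d with b in I and d in J, and then x * b = y * d^-1 lies in
    both of them: this is why the pairing is onto the fibre product. *)
Lemma pair_coset_fibre (A : skewBraceType) (I J : ideal A) :
  let qI : {skewbrace _ -> _} := quot_map (@sub_prodl A I J) in
  let qJ : {skewbrace _ -> _} := quot_map (@sub_prodr A I J) in
  exists g : {skewbrace A -> fibre_product qI qJ},
    [/\ forall a, fibre_val (g a) = (coset I a, coset J a),
        forall y, exists x, g x = y
      & ker g = inter_ideal I J].
Proof.
move=> qI qJ.
have gP a : (coset I a, coset J a) \in fibre_pred qI qJ.
  by rewrite unfold_in /fibre_pred /= !quot_mapE.
pose g a : fibre_product qI qJ := FibreProduct (gP a).
have gM : {morph g : x y / x * y}.
  by move=> x y; apply: val_inj; rewrite /= !coset_mul.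
have gB : {morph g : x y / x ** y}.
  by move=> x y; apply: val_inj; rewrite /= !coset_bul.
have [G GE] := morph_skewbrace gM gB; exists G; split.
- by move=> a; rewrite GE.
- move=> [[t r] tr]; have := tr; rewrite unfold_in /fibre_pred /= => /eqP.
  have [x tE] : exists x, t = coset I x by exists (repr t); rewrite coset_repr.
  have [y rE] : exists y, r = coset J y by exists (repr r); rewrite coset_repr.
  rewrite {1}tE {1}rE !quot_mapE => /coset_eqP [b Ib [d Jd bd]].
  exists (x * b); rewrite GE; apply: val_inj; congr (_, _) => /=.
    by rewrite coset_mulr.
  have -> : x * b = y * d^-1 by rewrite -[y](mulVKg x) -bd -!mulgA mulgV mulg1.
  by rewrite coset_mulr //; apply: idealV.
rewrite eqEsubset; split=> x; rewrite /ker /= GE.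
  by move=> /(congr1 val) [/coset1P Ix /coset1P Jx].
by move=> [Ix Jx]; apply: val_inj; congr (_, _); apply/coset1P.
Qed.

Theorem proposition4p5 (A : twoSidedSkewBraceType)
    (star_assoc : associative (@star A)) :
  let B := star_ideal A in
  let D := commutator_ideal A in
  let BD := prod_ideal B D in
  let I := inter_ideal B D in
  let T := quot B in
  let R := radring A in
  let C := quot BD in
  let qT : {skewbrace T -> C} := quot_map (@sub_prodl A B D) in
  let qR : {skewbrace R -> C} := quot_map (@sub_prodr A B D) in
  let TCR := fibre_product qT qR in
  [/\ (exists f : {skewbrace C -> quot (ring_square_ideal A)},
         bijective f /\
         forall a : A, f (coset BD a) =
                       coset (ring_square_ideal A) (coset D a)),
      is_brace C /\ trivial_skew_brace C,
      (exists phi : {skewbrace quot I -> TCR},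
         bijective phi /\
         forall a : A, fibre_val (phi (coset I a)) = (coset B a, coset D a))
    & (exists g : {skewbrace A -> TCR},
         [/\ forall a : A, fibre_val (g a) = (coset B a, coset D a),
             central_extension g & ker g = I]) /\
      I `<=` Ann A].
Proof.
move=> B D BD I T R C qT qR TCR.
have IAnn : I `<=` Ann A by exact: inter_ideal_Ann.
have [g [gE gsurj gker]] := pair_coset_fibre B D.
split; last split=> //.
- pose h (a : A) := coset (ring_square_ideal A) (coset D a : R).
  have hM : {morph h : x y / x * y} by move=> x y; rewrite /h !coset_mul.
  have hB : {morph h : x y / x ** y} by move=> x y; rewrite /h !coset_bul.
  have [H HE] := morph_skewbrace hM hB.
  have [p||f [fbij fE]] := @first_isomorphism _ _ BD H.
  + by exists (repr (repr p : R)); rewrite HE /h !coset_repr.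
  + have RsqE := ring_square_star A.
    rewrite eqEsubset; split=> x; rewrite /ker /= HE.
      by move=> /coset1P; rewrite /= RsqE => /star_subgroup_coset.
    by move=> BDx; apply/coset1P; rewrite /= RsqE; apply/star_subgroup_coset.
  by exists f; split=> // a; rewrite fE HE.
- exact: star_commutator_quot_trivial.
- have [phi [phibij phiE]] := first_isomorphism gsurj gker.
  by exists phi; split=> // a; rewrite phiE gE.
by exists g; split=> //; split=> //; rewrite gker.
Qed.
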